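(* Let $\Gamma$ and $\Gamma'$ be connected strongly regular graphs with parameters $(n,k,a,c)$ and $(n',k',a',c')$ and vertex sets $X$, $X'$ respectively. Then $\Gamma$ and $\Gamma'$ are $T$-isomorphic if and only if both (i) $(n,k,a,c)=(n',k',a',c')$, and (ii) for every pair of vertices $x\in X$ and $x'\in X'$, the local graph $\Delta_1(x)$ of $\Gamma$ and the local graph $\Delta'_1(x')$ of $\Gamma'$ have the same spectrum.
   Context: A strongly regular graph with parameters $(n,k,a,c)$ is a $k$-regular graph on $n$ vertices in which every pair of adjacent vertices has exactly $a$ common neighbours and every pair of distinct non-adjacent vertices has exactly $c$ common neighbours. For a graph $\Gamma$ with vertex set $X$, distance $\partial$, diameter $D$ and $x\in X$, $\Delta_1(x)$ is the subgraph induced on the neighbours of $x$. Let $V=\mathbb{C}^X$, $A$ the adjacency matrix, and $E^*_i(x)$ ($0\le i\le D$) the diagonal matrix with $(E^*_i(x))_{yy}=1$ if $\partial(x,y)=i$ and $0$ otherwise; $T(x)$ is the subalgebra of $\mathrm{Mat}_X(\mathbb{C})$ generated by $A,E^*_0(x),\dots,E^*_D(x)$. Use primes for the same objects of $\Gamma'$ (vertex set $X'$, $V'=\mathbb{C}^{X'}$, $A'$, $E'^*_i(x')$, $T'(x')$). Two such graphs of the same diameter $D$ are $T$-isomorphic if for every $x\in X$ and $x'\in X'$: $|X|=|X'|$, there is a $\mathbb{C}$-algebra isomorphism $f:T(x)\to T'(x')$ with $f(A)=A'$ and $f(E^*_i(x))=E'^*_i(x')$ for all $i$, and there is a $\mathbb{C}$-linear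 bijection $\rho:V\to V'$ with $\rho B=f(B)\rho$ for all $B\in T(x)$.
   Formalization: Strongly regular graphs are additionally required to be non-complete (some two distinct vertices are non-adjacent); for a complete graph the parameter c is undetermined, so the equivalence fails, e.g. K_2 with (2,1,0,0) and (2,1,0,1). *)

(* Defs.v *)
From mathcomp Require Import all_boot all_algebra complex.
From mathcomp Require Import Rstruct.
Set Implicit Arguments.
Unset Strict Implicit.
Unset Printing Implicit Defensive.
Import GRing.Theory.
Local Open Scope ring_scope.

Definition CC : numClosedFieldType := (Rdefinitions.R)[i].

Section Graphs.
Variable T : finType.
Variable e : rel T.

Definition connected_graph : Prop := forall x y : T, connect e x y.

Fixpoint ball (x : T) (m : nat) : {set T} :=
  match m with
  | 0 => [set x]
  | m'.+1 => ball x m' :|: [set z | [exists y in ball x m', e y z]]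
  end.

(* path-length distance (equals #|T| for unreachable vertices, which does not
   occur in a connected graph) *)
Definition dist (x y : T) : nat :=
  find (fun m => y \in ball x m) (iota 0 #|T|).

Definition diam : nat := \max_(x : T) \max_(y : T) dist x y.

(* strongly regular with parameters (n,k,a,c); following the standard
   convention, Gamma is neither complete nor edgeless (for a connected graph
   only "not complete" matters), so that the parameters are well defined. *)
Definition is_srg (n k a c : nat) : Prop :=
  [/\ #|T| = n,
      (forall x : T, #|[set y | e x y]| = k),
      (forall x y : T, x != y -> e x y -> #|[set z | e x z && e y z]| = a),
      (forall x y : T, x != y -> ~~ e x y -> #|[set z | e x z && e y z]| = c)
    & (exists x y : T, x != y /\ ~~ e x y)].

Definition adjmx : 'M[CC]_#|T| :=
  \matrix_(i, j) (e (enum_val i) (enum_val j))%:R.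

Definition Estar (x : T) (m : nat) : 'M[CC]_#|T| :=
  \matrix_(i, j) ((i == j) && (dist x (enum_val i) == m))%:R.

Definition nbhd (x : T) : {set T} := [set y | e x y].
Definition local_adjmx (x : T) : 'M[CC]_#|nbhd x| :=
  \matrix_(i, j) (e (@enum_val T (mem (nbhd x)) i)
                    (@enum_val T (mem (nbhd x)) j))%:R.

End Graphs.

Definition alg_gen (n : nat) (G : 'M[CC]_n -> Prop) (B : 'M[CC]_n) : Prop :=
  forall S : 'M[CC]_n -> Prop,
    S 1%:M ->
    (forall a u v, S u -> S v -> S (a *: u + v)) ->
    (forall u v, S u -> S v -> S (u *m v)) ->
    (forall g, G g -> S g) ->
    S B.

Definition Talg (T : finType) (e : rel T) (x : T) : 'M[CC]_#|T| -> Prop :=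
  alg_gen (fun M => M = adjmx e \/ exists2 m, (m <= diam e)%N & M = Estar e x m).

Definition alg_iso (n n' : nat) (S : 'M[CC]_n -> Prop) (S' : 'M[CC]_n' -> Prop)
    (f : 'M[CC]_n -> 'M[CC]_n') : Prop :=
  [/\ (forall B, S B -> S' (f B)),
      (forall B', S' B' -> exists2 B, S B & f B = B'),
      (forall B1 B2, S B1 -> S B2 -> f B1 = f B2 -> B1 = B2),
      f 1%:M = 1%:M /\
      (forall a B1 B2, S B1 -> S B2 -> f (a *: B1 + B2) = a *: f B1 + f B2)
    & (forall B1 B2, S B1 -> S B2 -> f (B1 *m B2) = f B1 *m f B2)].

Definition T_isomorphic (T T' : finType) (e : rel T) (e' : rel T') : Prop :=
  diam e = diam e' /\
  forall (x : T) (x' : T'),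
    #|T| = #|T'| /\
    exists f : 'M[CC]_#|T| -> 'M[CC]_#|T'|,
      [/\ alg_iso (Talg e x) (Talg e' x') f,
          f (adjmx e) = adjmx e',
          (forall m, (m <= diam e)%N -> f (Estar e x m) = Estar e' x' m)
        & exists rho : 'cV[CC]_#|T| -> 'cV[CC]_#|T'|,
            [/\ (forall a u v, rho (a *: u + v) = a *: rho u + rho v),
                bijective rho
              & (forall B, Talg e x B -> forall v, rho (B *m v) = f B *m rho v)]].

Definition spectrum (n : nat) (M : 'M[CC]_n) : CC -> nat :=
  fun l => mup l (char_poly M).

Definition same_spectrum (n n' : nat) (M : 'M[CC]_n) (M' : 'M[CC]_n') : Prop :=
  forall l : CC, spectrum M l = spectrum M' l.

(* Main.v *)
(* A T-isomorphism amounts to an invertible P with P A = A' P and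
   P E*_i = E'*_i P: the matrix of rho is such a P, and conversely conjugation by
   P is an isomorphism of the algebras.

   Given P, compressing to the neighbours of x shows that the local graphs are
   similar; E*_0 A^2 E*_0 = k E*_0 and E*_1 A^2 E*_0 = a A E*_0 recover k and a,
   and c follows from counting.

   Conversely, split A along E*_0, E*_1, E*_2 into the local adjacency matrix A_1,
   the off-diagonal block N and the second block H.  Cospectrality gives a
   unitary w with w A_1 = A_1' w fixing the all-ones vector.  The quadratic
   equation of A makes N N^* a polynomial in A_1 and J and gives N H = L N with
   L again such a polynomial, so H is determined on the range of N^*.  On
   the kernel of N the matrix H has only the two nontrivial eigenvalues r <> s of
   the graph, with multiplicities forced by dimension and trace; hence w extends
   to the second block. *)
Require Import Defs.
From mathcomp Require Import all_boot all_order all_algebra all_fingroup complex.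
From mathcomp Require Import Rstruct ring.
Set Implicit Arguments.
Unset Strict Implicit.
Unset Printing Implicit Defensive.
Import Order.TTheory GRing.Theory Num.Theory.
Local Open Scope ring_scope.
Local Open Scope sesquilinear_scope.

(** * Unitary similarity of cospectral Hermitian matrices *)

Section Adjoint.
Variable C : numClosedFieldType.

Lemma adj_mul m n p (A : 'M[C]_(m, n)) (B : 'M_(n, p)) :
  (A *m B)^t* = B^t* *m A^t*.
Proof. by rewrite trmx_mul map_mxM. Qed.

Lemma adjD m n (A B : 'M[C]_(m, n)) : (A + B)^t* = A^t* + B^t*.
Proof. by rewrite linearD map_mxD. Qed.

Lemma adjN m n (A : 'M[C]_(m, n)) : (- A)^t* = - A^t*.
Proof. by rewrite linearN map_mxN. Qed.

Lemma adjZ m n (z : C) (A : 'M[C]_(m, n)) : (z *: A)^t* = z^* *: A^t*.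
Proof. by rewrite linearZ map_mxZ. Qed.

Lemma adj1 n : (1%:M : 'M[C]_n)^t* = 1%:M.
Proof. by rewrite trmx1 map_mx1. Qed.

Lemma adj_mul_eq0 m n (X : 'M[C]_(m, n)) : X^t* *m X = 0 -> X = 0.
Proof.
move=> X0; apply/matrixP=> i j; rewrite mxE.
have /matrixP/(_ j j) := X0; rewrite !mxE.
under eq_bigr => l _ do rewrite !mxE mulrC -normCK.
move=> /eqP; rewrite psumr_eq0 => [/allP/(_ i)|l _]; last exact: exprn_ge0.
by rewrite mem_index_enum expf_eq0 /= normr_eq0 => /(_ isT)/eqP.
Qed.

Lemma unitarymx_adjl n (w : 'M[C]_n) : w \is unitarymx -> w^t* *m w = 1%:M.
Proof. by move=> /unitarymxP/mulmx1C. Qed.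

Lemma unitarymx_adjr n (w : 'M[C]_n) : w \is unitarymx -> w *m w^t* = 1%:M.
Proof. by move=> /unitarymxP. Qed.

Lemma char_poly_sim n (P Q A : 'M[C]_n) :
  P *m Q = 1%:M -> char_poly (P *m A *m Q) = char_poly A.
Proof.
move=> PQ; rewrite /char_poly.
suff -> : char_poly_mx (P *m A *m Q) =
    map_mx polyC P *m char_poly_mx A *m map_mx polyC Q.
  rewrite !det_mulmx mulrAC -det_mulmx -map_mxM PQ map_mx1 det1 mul1r //.
rewrite /char_poly_mx mulmxBr mulmxBl !map_mxM; congr (_ - _).
by rewrite scalar_mxC -mulmxA -map_mxM PQ map_mx1 mulmx1.
Qed.

End Adjoint.

Lemma spectrum_similar (n : nat) (P Q A : 'M[CC]_n) :
  P *m Q = 1%:M -> same_spectrum (P *m A *m Q) A.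
Proof. by move=> PQ l; rewrite /spectrum char_poly_sim. Qed.

(** In a rank factorisation [E = K R], the outer factors of [K R K R = K R] cancel and leave
    [R K = 1]; hence the trace of an idempotent is its rank. *)
Lemma idempotent_factor (F : fieldType) n (E : 'M[F]_n) : E *m E = E ->
  exists r (K : 'M_(n, r)) (R : 'M_(r, n)), [/\ E = K *m R, R *m K = 1%:M & \tr E = r%:R].
Proof.
move=> EE; exists (\rank E).
have := mxtrace_mulC (col_base E) (row_base E).
move: (col_base E) (row_base E) (mulmx_base E) (col_base_full E) (row_base_free E).
move=> K R KR Kfull Rfree trKR; exists K, R.
have RK : R *m K = 1%:M.
  apply: (row_free_inj Rfree); apply: (row_full_inj Kfull).
  by rewrite /= mul1mx !mulmxA KR -mulmxA KR EE.
by split=> //; rewrite -{1}KR trKR RK mxtrace1.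
Qed.

(** Equal traces mean equal ranks, so both rank factorisations pass through the same middle space,
    and [U = K' R], [V = K R'] identify the two images. *)
Lemma idempotent_equiv (C : numClosedFieldType) n (E E' : 'M[C]_n) :
  E *m E = E -> E' *m E' = E' -> \tr E = \tr E' ->
  exists U V, [/\ U *m V = E', V *m U = E, E' *m U *m E = U & E *m V *m E' = V].
Proof.
move=> /idempotent_factor[r [K [R [-> RK ->]]]].
move=> /idempotent_factor[r' [K' [R' [-> RK' ->]]]] /eqP.
rewrite eqr_nat => /eqP rr'; subst r'.
exists (K' *m R), (K *m R'); split.
- by rewrite mulmxA -[K' *m R *m K]mulmxA RK mulmx1.
- by rewrite mulmxA -[K *m R' *m K']mulmxA RK' mulmx1.
- by rewrite !mulmxA -[K' *m R' *m K']mulmxA RK' mulmx1 -[K' *m R *m K]mulmxA RK mulmx1.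
- by rewrite !mulmxA -[K *m R *m K]mulmxA RK mulmx1 -[K *m R' *m K']mulmxA RK' mulmx1.
Qed.

Lemma herm_spectral (C : numClosedFieldType) n (A : 'M[C]_n) : A^t* = A ->
  exists2 P : 'M[C]_n, P \is unitarymx & exists d, P *m A = diag_mx d *m P.
Proof.
move=> hA; exists (spectralmx A); first exact: spectral_unitarymx.
exists (spectral_diag A).
have /orthomx_spectralP {2}-> : A \is normalmx by apply/normalmxP; rewrite hA.
by rewrite !mulmxA mulmxV ?spectral_unit // mul1mx.
Qed.

Lemma perm_mx_unitary (C : numClosedFieldType) n (s : 'S_n) :
  (perm_mx s : 'M[C]_n) \is unitarymx.
Proof.
apply/unitarymxP; rewrite tr_perm_mx map_perm_mx -perm_mxM.
by rewrite mulgV perm_mx1.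
Qed.

(** Both matrices are unitarily diagonalised; equal characteristic roots with multiplicity make one
    diagonal a permutation of the other, so [w] is composed of the two diagonalisations and a
    permutation matrix. *)
Lemma herm_cospectral n (A B : 'M[CC]_n) : A^t* = A -> B^t* = B ->
  same_spectrum A B ->
  exists2 w, w \is unitarymx & w *m A = B *m w.
Proof.
move=> /herm_spectral[P uP [d dP]] /herm_spectral[Q uQ [f fQ]] AB.
have cp M (R : 'M[CC]_n) g : R \is unitarymx -> R *m M = diag_mx g *m R ->
    forall l, spectrum M l = count_mem l [tuple g 0 i | i < n].
  move=> uR gR l; rewrite -(spectrum_similar M (unitarymx_adjr uR)) gR mulmxtVK //.
  rewrite /spectrum char_poly_trig ?diag_mx_is_trig // -mu_prod_XsubC.
  rewrite big_tuple; congr (mup _ _); apply: eq_bigr => i _.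
  by rewrite tnth_mktuple mxE eqxx mulr1n.
have /tuple_permP[s /val_inj Es] :
    perm_eq [tuple d 0 i | i < n] [tuple f 0 i | i < n].
  by apply/allP => l _ /=; rewrite -(cp _ _ _ uP dP) -(cp _ _ _ uQ fQ) AB.
have {}Es i : d 0 i = f 0 (s i).
  by have := congr1 (fun t => tnth t i) Es; rewrite !tnth_mktuple.
have DS : diag_mx d *m perm_mx s = perm_mx s *m diag_mx f.
  apply/matrixP=> i j; rewrite mul_diag_mx mul_mx_diag !mxE.
  by rewrite Es; case: eqP => [<-|_]; rewrite ?mulr0 ?mul0r // mulrC.
exists (Q^t* *m (perm_mx s)^t* *m P).
  by rewrite !mul_unitarymx ?trmxC_unitary ?perm_mx_unitary.
have DS' : (perm_mx s)^t* *m diag_mx d = diag_mx f *m (perm_mx s)^t*.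
  have S1 := unitarymx_adjl (perm_mx_unitary CC s).
  have S2 := unitarymx_adjr (perm_mx_unitary CC s).
  by rewrite -[LHS]mulmx1 -S2 -!mulmxA [diag_mx d *m _]mulmxA DS !mulmxA S1 mul1mx.
have fQ' : Q^t* *m diag_mx f = B *m Q^t*.
  rewrite -[LHS]mulmx1 -(unitarymx_adjr uQ) !mulmxA -[Q^t* *m _ *m Q]mulmxA -fQ.
  by rewrite mulmxA unitarymx_adjl // mul1mx.
by rewrite -mulmxA dP !mulmxA -[Q^t* *m _ *m diag_mx d]mulmxA DS' mulmxA fQ'.
Qed.

(* The complex Householder map 1 - g g^* / (g^* x) with g = x - y is unitary
   because |x| = |y| forces 2 Re (g^* x) = |g|^2. *)
Lemma unitary_swap (C : numClosedFieldType) n (B : 'M[C]_n) (x y : 'cV_n) (l : C) :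
  B^t* = B -> l^* = l -> B *m x = l *: x -> B *m y = l *: y ->
  x^t* *m x = y^t* *m y ->
  exists2 h, h \is unitarymx & B *m h = h *m B /\ h *m x = y.
Proof.
move=> hB hl Bx By xy; have [g Eg] : exists g, g = x - y by exists (x - y).
pose ga := (g^t* *m x) 0 0; pose de := (g^t* *m g) 0 0.
have Ega : g^t* *m x = ga%:M by exact: mx11_scalar.
have Ede : g^t* *m g = de%:M by exact: mx11_scalar.
have gade : ga + ga^* = de.
  suff : g^t* *m x + (g^t* *m x)^t* = g^t* *m g.
    by move=> /matrixP/(_ 0 0); rewrite /ga /de mxE => <-; rewrite !mxE.
  rewrite adj_mul trmxCK Eg adjD adjN !(mulmxBl, mulmxBr) -xy.
  by rewrite opprB addrC.
have Bg : g^t* *m B = l *: g^t*.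
  by rewrite -{1}hB -adj_mul Eg mulmxBr Bx By -scalerBr adjZ hl.
(* If [ga = 0] then [de = 2 Re ga] vanishes too, so [x = y] and the identity serves. *)
have [ga0|ga0] := eqVneq ga 0.
  have g0 : g = 0.
    apply: adj_mul_eq0; rewrite Ede -gade ga0 conjC0 addr0.
    by apply/matrixP=> i j; rewrite !mxE mul0rn.
  exists 1%:M; first by apply/unitarymxP; rewrite adj1 mulmx1.
  by rewrite mulmx1 !mul1mx; split => //; apply/eqP; rewrite -subr_eq0 -Eg g0.
exists (1%:M - ga^-1 *: (g *m g^t*)); last split.
- apply/unitarymxP; rewrite adjD adjN adj1 adjZ adj_mul trmxCK fmorphV.
  rewrite mulmxBl mul1mx mulmxBr mulmx1 -!scalemxAl -!scalemxAr.
  rewrite !mulmxA -[g *m _ *m g]mulmxA Ede mul_mx_scalar -scalemxAl -gade.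
  rewrite -addrA -[RHS]addr0; congr (_ + _).
  have ga'0 : ga^* != 0 by rewrite conjC_eq0.
  rewrite !scalerA -!scaleNr -!scalerDl -scalerBl.
  (* The coefficient of [g g^t*] vanishes because the squared norm of [g] is [ga + ga^*]. *)
  have -> : - ga^*^-1 - (ga^-1 - ga^-1 * (ga^*^-1 * (ga + ga^*))) = 0.
    by field; rewrite ga0 ga'0.
  by rewrite scale0r.
- rewrite mulmxBr mulmxBl mulmx1 mul1mx -scalemxAr -scalemxAl mulmxA
  -[g *m _ *m B]mulmxA Bg.
  by rewrite {1}Eg mulmxBr Bx By -scalerBr -Eg -scalemxAl -scalemxAr.
- rewrite mulmxBl mul1mx -scalemxAl -mulmxA Ega mul_mx_scalar scalerA mulVf // scale1r.
  by rewrite Eg opprB addrC subrK.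
Qed.

(** [j] and [w j] are eigenvectors of [B] for the same real eigenvalue and have equal norm, so a
    unitary commuting with [B] moves the second back to the first. *)
Lemma herm_cospectral_fix n (A B : 'M[CC]_n) (j : 'cV_n) (l : CC) :
  A^t* = A -> B^t* = B -> same_spectrum A B ->
  l^* = l -> A *m j = l *: j -> B *m j = l *: j ->
  exists2 w, w \is unitarymx & w *m A = B *m w /\ w *m j = j.
Proof.
move=> hA hB /(herm_cospectral hA hB)[w uw wA] hl Aj Bj.
have Bwj : B *m (w *m j) = l *: (w *m j) by rewrite mulmxA -wA -mulmxA Aj -scalemxAr.
have nwj : (w *m j)^t* *m (w *m j) = j^t* *m j.
  by rewrite adj_mul mulmxA -[_ *m w^t* *m w]mulmxA unitarymx_adjl // mulmx1.
have [h uh [Bh hwj]] := unitary_swap hB hl Bwj Bj nwj.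
exists (h *m w); first by rewrite mul_unitarymx.
by rewrite -!mulmxA wA hwj !mulmxA Bh.
Qed.

(** * Extending an intertwiner across an off-diagonal block *)

(** [S = pinvmx M] enters only as a generalised inverse, [M S M = M]. Positivity makes whatever
    kills [M] kill [N], so [N^t* S N] is an idempotent with the range of [N^t*]. *)
Lemma gram_pinv_mul (C : numClosedFieldType) k n (N : 'M[C]_(k, n)) :
  let M := N *m N^t* in
  M *m pinvmx M *m N = N /\ N^t* *m pinvmx M *m M = N^t*.
Proof.
move=> M; set S := pinvmx M.
have MSM : M *m S *m M = M by exact: mulmxKpV.
have hM : M^t* = M by rewrite adj_mul trmxCK.
have annih (X : 'M_k) : X *m M = 0 -> X *m N = 0.
  move=> XM; rewrite -[RHS](trmxCK 0) -[LHS]trmxCK; congr (_^t*).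
  have -> : 0^t* = 0 :> 'M[C]_(n, k) by rewrite trmx0 map_mx0.
  apply: adj_mul_eq0; rewrite trmxCK adj_mul mulmxA -[X *m N *m _]mulmxA.
  by rewrite -/M XM mul0mx.
split; apply/eqP; rewrite -subr_eq0; apply/eqP.
  by rewrite -{2}[N]mul1mx -mulmxBl annih // mulmxBl MSM mul1mx subrr.
rewrite -mulmxA -{2}[N^t*]mulmx1 -mulmxBr -[RHS]trmxCK -[LHS]trmxCK; congr (_^t*).
rewrite adj_mul trmxCK trmx0 map_mx0 annih //.
have -> : (S *m M - 1%:M)^t* *m M = (M *m (S *m M - 1%:M))^t* by rewrite adj_mul hM.
by rewrite mulmxBr mulmxA MSM mulmx1 subrr trmx0 map_mx0.
Qed.

(* [N] and [H] are two blocks of a Hermitian matrix, cut out by the projection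
   [E]; on the kernel of [N] the roots of [H] are [r] and [s]. *)
Definition corner_system (C : numClosedFieldType) k n (r s : C) (L : 'M[C]_k)
    (N : 'M_(k, n)) (E H : 'M_n) : Prop :=
  [/\ E *m E = E /\ E^t* = E, N *m E = N, [/\ H *m E = H, E *m H = H & H^t* = H],
      N *m H = L *m N
    & exists Z, H *m H = (r + s) *: H - (r * s) *: E + Z *m N].

(** [F = E - N^t* S N] projects onto the part of the kernel of [N] inside the image of [E]. It
    commutes with [H] and kills the term [Z N], so on its image [H] satisfies a quadratic with roots
    [r] and [s], and [F] splits into two eigenprojections. Their traces depend only on [L], [M] and
    the traces of [E] and [H]. *)
Lemma kernel_eigenprojections (C : numClosedFieldType) k n (r s : C) (L : 'M[C]_k)
    (N : 'M_(k, n)) (E H : 'M_n) (M := N *m N^t*) :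
  r != s -> L^t* = L -> corner_system r s L N E H ->
  exists Fr Fs,
  [/\ [/\ Fr *m Fr = Fr, Fs *m Fs = Fs, Fr *m Fs = 0 & Fs *m Fr = 0],
      [/\ N *m Fr = 0, N *m Fs = 0, Fr *m N^t* = 0 & Fs *m N^t* = 0],
      [/\ E *m Fr = Fr, E *m Fs = Fs, Fr *m E = Fr & Fs *m E = Fs],
      [/\ H *m Fr = r *: Fr, H *m Fs = s *: Fs, Fr *m H = r *: Fr &
          Fs *m H = s *: Fs] &
      [/\ N^t* *m pinvmx M *m N + (Fr + Fs) = E,
      \tr Fr = (r - s)^-1 *
        (\tr H - \tr (L *m pinvmx M *m M) - s * (\tr E - \tr (pinvmx M *m M))) &
      \tr Fs = (s - r)^-1 *
        (\tr H - \tr (L *m pinvmx M *m M) - r * (\tr E - \tr (pinvmx M *m M)))]].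
Proof.
move=> rs hL [[EE hE] NE [HE EH hH] NH [Z HH]].
have [MSN NSM] := gram_pinv_mul N; rewrite -/M in MSN NSM *.
move: (pinvmx M) MSN NSM => S MSN NSM.
have EN : E *m N^t* = N^t* by rewrite -{1}hE -adj_mul NE.
have HN : H *m N^t* = N^t* *m L by rewrite -{1}hH -adj_mul NH adj_mul hL.
have [F EF] : exists F, F = E - N^t* *m S *m N by exists (E - N^t* *m S *m N).
have NF : N *m F = 0 by rewrite EF mulmxBr NE !mulmxA MSN subrr.
have FN : F *m N^t* = 0 by rewrite EF mulmxBl EN -[_ *m N *m N^t*]mulmxA -/M NSM subrr.
have FE : F *m E = F by rewrite EF mulmxBl EE -[_ *m N *m E]mulmxA NE.
have EF' : E *m F = F by rewrite EF mulmxBr EE !mulmxA EN.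
have FF : F *m F = F by rewrite {2}EF mulmxBr FE !mulmxA FN !mul0mx subr0.
have FHF1 : F *m H *m F = F *m H.
  by rewrite {2}EF mulmxBr -[F *m H *m E]mulmxA HE -!mulmxA [H *m (N^t* *m _)]mulmxA HN
    !mulmxA FN !mul0mx subr0.
have FHF2 : F *m H *m F = H *m F.
  by rewrite {1}EF mulmxBl mulmxBl EH -[N^t* *m S *m N *m H]mulmxA NH -!mulmxA NF
    !mulmx0 subr0.
have FH : F *m H = H *m F by rewrite -FHF1 FHF2.
have HHF : H *m (H *m F) = (r + s) *: (H *m F) - (r * s) *: F.
  rewrite mulmxA HH mulmxDl mulmxBl -!scalemxAl EF' -mulmxA NF mulmx0 addr0 //.
have trF : \tr F = \tr E - \tr (S *m M).
  by rewrite EF linearB /= -mulmxA mxtrace_mulC -mulmxA.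
have trHF : \tr (H *m F) = \tr H - \tr (L *m S *m M).
  by rewrite EF mulmxBr linearB /= HE !mulmxA HN -!mulmxA mxtrace_mulC -!mulmxA.
(* [G r s] and [G s r] are the Lagrange interpolation idempotents of [H] on the image of [F]. *)
pose G (x y : C) := (x - y)^-1 *: (H *m F - y *: F).
have GN x y : N *m G x y = 0.
  by rewrite -scalemxAr mulmxBr mulmxA NH -mulmxA
    -scalemxAr NF mulmx0 scaler0 subr0 scaler0.
have GN' x y : G x y *m N^t* = 0.
  by rewrite -scalemxAl mulmxBl -mulmxA -scalemxAl FN mulmx0 scaler0 subr0 scaler0.
have GE x y : G x y *m E = G x y.
  by rewrite -scalemxAl mulmxBl -mulmxA -scalemxAl FE.
have EG x y : E *m G x y = G x y.
  by rewrite -scalemxAr mulmxBr mulmxA -scalemxAr EF' EH.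
have GH x y : G x y *m H = H *m G x y.
  by rewrite -scalemxAl -scalemxAr mulmxBl mulmxBr -mulmxA -scalemxAl -scalemxAr FH.
have FG x y : F *m G x y = G x y.
  by rewrite -scalemxAr mulmxBr mulmxA -scalemxAr FH -mulmxA FF.
have HG x y : x + y = r + s -> x * y = r * s -> H *m G x y = x *: G x y.
  move=> xy1 xy2; rewrite /G -scalemxAr mulmxBr HHF -scalemxAr -xy1 -xy2.
  by rewrite scalerDl addrAC addrK -scalerA -scalerBr !scalerA mulrC.
have GG x y z t : x + y = r + s -> x * y = r * s ->
    G z t *m G x y = ((z - t)^-1 * (x - t)) *: G x y.
  move=> xy1 xy2; rewrite -scalemxAl mulmxBl -mulmxA FG HG // -scalemxAl FG.
  by rewrite -scalerBl scalerA.
have srD : s + r = r + s by rewrite addrC.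
have srM : s * r = r * s by rewrite mulrC.
have rs0 : r - s != 0 by rewrite subr_eq0.
have sr0 : s - r != 0 by rewrite subr_eq0 eq_sym.
exists (G r s), (G s r); split; first split.
- by rewrite GG // mulVf // scale1r.
- by rewrite GG // mulVf // scale1r.
- by rewrite GG // subrr mulr0 scale0r.
- by rewrite GG // subrr mulr0 scale0r.
- by split.
- by split.
- by split; rewrite ?GH HG.
split.
- have -> : G r s + G s r = F.
    have E1 : (s - r)^-1 = - (r - s)^-1 by rewrite -invrN opprB.
    rewrite /G E1 scaleNr -scalerBr opprB [_ + (r *: F - _)]addrC addrA subrK.
    by rewrite -scalerBl scalerA mulVf // scale1r.
  by rewrite EF addrC subrK.
- by rewrite linearZ linearB linearZ /= trHF trF.
- by rewrite linearZ linearB linearZ /= trHF trF.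
Qed.
(** On the range of [N^t*] the map is forced: [N^t* v] goes to [N'^t* v], and [H N^t* = N^t* L]
    makes it respect [H]. On the kernel of [N] corresponding eigenprojections have equal traces, so
    any identification of the eigenspaces respects [H]. *)
Lemma corner_intertwiner (C : numClosedFieldType) k n (r s : C) (L : 'M[C]_k)
    (N N' : 'M_(k, n)) (E E' H H' : 'M_n) :
  r != s -> L^t* = L -> corner_system r s L N E H -> corner_system r s L N' E' H' ->
  N *m N^t* = N' *m N'^t* -> \tr E = \tr E' -> \tr H = \tr H' ->
  exists P Q,
  [/\ [/\ P *m Q = E', Q *m P = E, P *m E = P & E' *m P = P],
      E *m Q = Q /\ Q *m E' = Q &
      [/\ N' *m P = N, P *m N^t* = N'^t* & P *m H = H' *m P]].
Proof.
move=> rs hL cs cs' NN' trE trH.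
have [Fr [Fs [[FrFr FsFs FrFs FsFr] [NFr NFs FrN FsN] [EFr EFs FrE FsE]
  [HFr HFs FrH FsH] [sumF trFr trFs]]]] := kernel_eigenprojections rs hL cs.
have [Fr' [Fs' [[FrFr' FsFs' FrFs' FsFr'] [NFr' NFs' FrN' FsN'] [EFr' EFs' FrE' FsE']
  [HFr' HFs' FrH' FsH'] [sumF' trFr' trFs']]]] := kernel_eigenprojections rs hL cs'.
have [MSN NSM] := gram_pinv_mul N; have [MSN' NSM'] := gram_pinv_mul N'.
case: cs cs' => [[EE hE] NE [HE EH hH] NH _] [[EE' hE'] NE' [HE' EH' hH'] NH' _].
(* Equality of the Gram matrices lets one generalised inverse [S] serve both systems. *)
move: (NN') sumF sumF' trFr trFs trFr' trFs' MSN NSM MSN' NSM' => <-.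
move: (pinvmx _) => S sumF sumF' trFr trFs trFr' trFs' MSN NSM MSN' NSM'.
have HN : H *m N^t* = N^t* *m L by rewrite -{1}hH -adj_mul NH adj_mul hL.
have HN' : H' *m N'^t* = N'^t* *m L by rewrite -{1}hH' -adj_mul NH' adj_mul hL.
(* Both sides equal [N H N^t*]. *)
have LM : N *m N^t* *m L = L *m (N *m N^t*) by rewrite -mulmxA -HN !mulmxA NH.
have [Ur [Vr [UVr VUr Ure Vre]]] : exists U V, [/\ U *m V = Fr', V *m U = Fr,
    Fr' *m U *m Fr = U & Fr *m V *m Fr' = V].
  by apply: idempotent_equiv; rewrite // trFr trFr' trE trH.
have [Us [Vs [UVs VUs Use Vse]]] : exists U V, [/\ U *m V = Fs', V *m U = Fs,
    Fs' *m U *m Fs = U & Fs *m V *m Fs' = V].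
  by apply: idempotent_equiv; rewrite // trFs trFs' trE trH.
pose P := N'^t* *m S *m N + (Ur + Us); pose Q := N^t* *m S *m N' + (Vr + Vs).
have NVr : N *m Vr = 0 by rewrite -Vre !mulmxA NFr !mul0mx.
have NVs : N *m Vs = 0 by rewrite -Vse !mulmxA NFs !mul0mx.
have NUr : N' *m Ur = 0 by rewrite -Ure !mulmxA NFr' !mul0mx.
have NUs : N' *m Us = 0 by rewrite -Use !mulmxA NFs' !mul0mx.
have UNr : Ur *m N^t* = 0 by rewrite -Ure -!mulmxA FrN !mulmx0.
have UNs : Us *m N^t* = 0 by rewrite -Use -!mulmxA FsN !mulmx0.
have VNr : Vr *m N'^t* = 0 by rewrite -Vre -!mulmxA FrN' !mulmx0.
have VNs : Vs *m N'^t* = 0 by rewrite -Vse -!mulmxA FsN' !mulmx0.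
have UVrs : Ur *m Vs = 0 by rewrite -Ure -Vse !mulmxA -[_ *m Fr *m Fs]mulmxA FrFs mulmx0
  !mul0mx.
have UVsr : Us *m Vr = 0 by rewrite -Use -Vre !mulmxA -[_ *m Fs *m Fr]mulmxA FsFr mulmx0
  !mul0mx.
have VUrs : Vr *m Us = 0 by rewrite -Vre -Use !mulmxA
  -[_ *m Fr' *m Fs']mulmxA FrFs' mulmx0 !mul0mx.
have VUsr : Vs *m Ur = 0 by rewrite -Vse -Ure !mulmxA
  -[_ *m Fs' *m Fr']mulmxA FsFr' mulmx0 !mul0mx.
have NP : N' *m P = N.
  by rewrite /P !mulmxDr NUr NUs !addr0 !mulmxA -NN' MSN.
have NQ : N *m Q = N'.
  by rewrite /Q !mulmxDr NVr NVs !addr0 !mulmxA MSN'.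
have PN : P *m N^t* = N'^t*.
  by rewrite /P !mulmxDl UNr UNs !addr0 -mulmxA NSM'.
have PQ : P *m Q = E'.
  rewrite {1}/P !mulmxDl -mulmxA NQ -sumF'; congr (_ + _).
  rewrite /Q !mulmxDr !mulmxA UNr UNs !mul0mx !add0r UVr UVs UVrs UVsr.
  by rewrite addr0 add0r.
have QP : Q *m P = E.
  rewrite {1}/Q !mulmxDl -mulmxA NP -sumF; congr (_ + _).
  rewrite /P !mulmxDr !mulmxA VNr VNs !mul0mx !add0r VUr VUs VUrs VUsr.
  by rewrite addr0 add0r.
have EN : E *m N^t* = N^t* by rewrite -{1}hE -adj_mul NE.
have EN' : E' *m N'^t* = N'^t* by rewrite -{1}hE' -adj_mul NE'.
exists P, Q; split; [split=> // | split | split=> //].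
- rewrite /P !mulmxDl -mulmxA NE; congr (_ + (_ + _)).
    by rewrite -Ure -mulmxA FrE.
  by rewrite -Use -mulmxA FsE.
- rewrite /P !mulmxDr !mulmxA EN'; congr (_ + (_ + _)).
    by rewrite -Ure !mulmxA EFr'.
  by rewrite -Use !mulmxA EFs'.
- rewrite /Q !mulmxDr !mulmxA EN; congr (_ + (_ + _)).
    by rewrite -Vre !mulmxA EFr.
  by rewrite -Vse !mulmxA EFs.
- rewrite /Q !mulmxDl -mulmxA NE'; congr (_ + (_ + _)).
    by rewrite -Vre -mulmxA FrE'.
  by rewrite -Vse -mulmxA FsE'.
- rewrite /P !mulmxDl !mulmxDr; congr (_ + (_ + _)).
  (* [L] need not commute with [S] itself, so [N'^t* = N'^t* S M] supplies a factor [M], with which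
     [L] does commute. *)
  + rewrite -mulmxA NH !mulmxA HN' -[in RHS]NSM' -[_ *m (_ *m _) *m L]mulmxA LM.
    by rewrite -!mulmxA; do 3!congr (_ *m _); rewrite !mulmxA MSN.
  + by rewrite -Ure -mulmxA FrH !mulmxA HFr' -scalemxAr -!scalemxAl.
  + by rewrite -Use -mulmxA FsH !mulmxA HFs' -scalemxAr -!scalemxAl.
Qed.

(** * The block structure of a strongly regular graph *)

Local Notation ones n := (const_mx 1 : 'cV_n).

(* [A] is the adjacency matrix, [d] the unit vector of the base vertex [x], and
   the columns of [I] are the unit vectors of the neighbours of [x]. *)
Definition srg_model (C : numClosedFieldType) (k a c : nat) n m
    (A : 'M[C]_n) (d : 'cV_n) (I : 'M_(n, m)) : Prop :=
  [/\ A^t* = A /\ \tr A = 0,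
      A *m A = (k%:R - c%:R)%:M + (a%:R - c%:R) *: A
               + c%:R *: (ones n *m (ones n)^t*),
      [/\ d^t* *m d = 1%:M, I^t* *m I = 1%:M & d^t* *m I = 0],
      d^t* *m ones n = 1%:M /\ I^t* *m ones n = ones m
    & A *m d = I *m ones m].

Section Model.
Variables (C : numClosedFieldType) (k a c n m : nat).
Variables (A : 'M[C]_n) (d : 'cV[C]_n) (I : 'M[C]_(n, m)).
Hypothesis modA : srg_model k a c A d I.

Let j : 'cV[C]_m := ones m.
Let u : 'cV[C]_n := ones n.
Let A1 := I^t* *m A *m I.
(** [E] projects off the base vertex and its neighbours. [N] and [H] keep the full index [n], padded
    by zeros, so no index set for the second neighbourhood is needed. *)
Let E := 1%:M - d *m d^t* - I *m I^t*.
Let N := I^t* *m A *m E.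
Let H := E *m A *m E.

Lemma model_local_herm : A1^t* = A1.
Proof. by case: modA => [[hA _] _ _ _ _]; rewrite !adj_mul trmxCK hA mulmxA. Qed.

Lemma model_sandwich p q (X : 'M_(p, n)) (Y : 'M_(n, q)) :
  X *m (A *m A) *m Y = (k%:R - c%:R) *: (X *m Y) + (a%:R - c%:R) *: (X *m A *m Y)
     + c%:R *: (X *m u *m (u^t* *m Y)).
Proof.
case: modA => [_ -> _ _ _]; rewrite !mulmxDr !mulmxDl mul_mx_scalar -!scalemxAl.
by rewrite -!scalemxAr -!scalemxAl !mulmxA.
Qed.

Lemma model_complement :
  [/\ E *m E = E, E^t* = E, [/\ d^t* *m E = 0, I^t* *m E = 0, E *m d = 0 & E *m I = 0]
    & d^t* *m A *m E = 0].
Proof.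
case: modA => [[hA _] _ [dd II dI] _ Ad].
have Id : I^t* *m d = 0 by rewrite -[I^t* *m d]trmxCK adj_mul trmxCK dI trmx0 map_mx0.
have hE : E^t* = E by rewrite /E !adjD !adjN adj1 !adj_mul !trmxCK.
have dE : d^t* *m E = 0.
  by rewrite /E !mulmxBr mulmx1 !mulmxA dd dI mul1mx mul0mx subr0 subrr.
have IE : I^t* *m E = 0.
  by rewrite /E !mulmxBr mulmx1 !mulmxA II Id mul1mx mul0mx subr0 subrr.
split=> //.
- by rewrite {1}/E !mulmxBl mul1mx -!mulmxA dE IE !mulmx0 !subr0.
- split=> //; rewrite -[LHS]trmxCK adj_mul hE.
    by rewrite dE trmx0 map_mx0.
  by rewrite IE trmx0 map_mx0.
- by rewrite -{1}hA -adj_mul Ad adj_mul -mulmxA IE mulmx0.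
Qed.

(** Substituting for [E] trades a walk through the second block for [A^2], where the quadratic
    equation applies, minus the walks through the base vertex and through its neighbours. *)
Lemma model_middle p q (X : 'M_(p, n)) (Y : 'M_(n, q)) :
  X *m A *m E *m A *m Y = X *m (A *m A) *m Y - X *m I *m j *m (d^t* *m A *m Y)
   - X *m A *m I *m (I^t* *m A *m Y).
Proof.
case: modA => [_ _ _ _ Ad].
rewrite /E !mulmxBr !mulmxBl mulmx1 !mulmxA.
by rewrite -[X *m A *m d]mulmxA Ad !mulmxA.
Qed.

(** This is the block of the quadratic equation from the base vertex to its neighbours. *)
Lemma model_local_regular : A1 *m j = a%:R *: j.
Proof.
case: modA => [[hA _] _ [dd II dI] [du Iu] Ad].
have Id : I^t* *m d = 0 by rewrite -[I^t* *m d]trmxCK adj_mul trmxCK dI trmx0 map_mx0.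
have ud : u^t* *m d = 1%:M by rewrite -[u^t* *m d]trmxCK adj_mul trmxCK du adj1.
have := model_sandwich (I^t*) d.
rewrite Id scaler0 add0r -[_ *m A *m d]mulmxA Ad
  [I^t* *m (I *m _)]mulmxA II mul1mx ud mulmx1 Iu.
by rewrite -scalerDl subrK mulmxA -[I^t* *m A *m A *m d]mulmxA Ad mulmxA.
Qed.

(** This is the block of the quadratic equation from the base vertex to the second neighbourhood,
    since [A d = I j]. *)
Lemma model_N_ones : N^t* *m j = c%:R *: (E *m u).
Proof.
have [EE hE [dE IE Ed EI] dAE] := model_complement.
case: modA => [[hA _] _ [dd II dI] [du Iu] Ad].
have ud : u^t* *m d = 1%:M by rewrite -[u^t* *m d]trmxCK adj_mul trmxCK du adj1.
have := model_sandwich E d.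
rewrite Ed scaler0 add0r -[E *m A *m d]mulmxA Ad
  [E *m (I *m _)]mulmxA EI mul0mx scaler0 add0r.
rewrite ud mulmx1 => <-; rewrite /N !adj_mul trmxCK hA hE -!mulmxA.
by rewrite Ad.
Qed.

Lemma model_decomposition :
  A = (I *m j) *m d^t* + (d *m j^t* + I *m A1 + N^t*) *m I^t* + I *m N + H.
Proof.
have [EE hE [dE IE Ed EI] dAE] := model_complement.
case: modA => [[hA _] _ [dd II dI] [du Iu] Ad].
have sum1 : 1%:M = d *m d^t* + I *m I^t* + E by rewrite /E -[_ - _ - _]addrA -opprD
  [RHS]addrC subrK.
clearbody E.
have Adj : d^t* *m A = j^t* *m I^t* by rewrite -{1}hA -adj_mul Ad adj_mul.
have ANI : d *m j^t* + I *m A1 + N^t* = A *m I.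
  rewrite /N !adj_mul hA hE trmxCK -[RHS]mul1mx sum1 !mulmxDl; congr (_ + _ + _).
    by rewrite -mulmxA [d^t* *m _]mulmxA Adj -mulmxA II mulmx1.
  by rewrite /A1 !mulmxA.
have AE : A *m E = I *m N + H.
  by rewrite -[LHS]mul1mx sum1 !mulmxDl -mulmxA [d^t* *m _]mulmxA dAE mulmx0 add0r !mulmxA.
rewrite ANI -addrA -AE -[LHS]mulmx1 {1}sum1 !mulmxDr -Ad !mulmxA //.
Qed.

(** The matrix for which [N H = L N]; its term [j j^t*] arises because [c u^t* E = j^t* N]. *)
Let L := (a%:R - c%:R)%:M - A1 + j *m j^t*.

Lemma model_L_herm : L^t* = L.
Proof.
rewrite /L !adjD adjN model_local_herm adj_mul trmxCK.
by rewrite tr_scalar_mx map_scalar_mx rmorphB !rmorph_nat.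
Qed.

Lemma model_gram :
  N *m N^t* = (k%:R - c%:R)%:M + (a%:R - c%:R) *: A1 + c%:R *: (j *m j^t*)
     - j *m j^t* - A1 *m A1.
Proof.
have [EE hE [dE IE Ed EI] dAE] := model_complement.
case: modA => [[hA _] _ [dd II dI] [du Iu] Ad].
have Adj : d^t* *m A = j^t* *m I^t* by rewrite -{1}hA -adj_mul Ad adj_mul.
rewrite /N !adj_mul hA hE trmxCK !mulmxA -[_ *m E *m E]mulmxA EE.
rewrite model_middle model_sandwich II scalemx1 Iu Adj
  -[_ *m I^t* *m I]mulmxA II mulmx1 mul1mx.
rewrite -/A1; congr (_ + _ *: (_ *m _) - _ - _).
  by rewrite -[LHS]trmxCK adj_mul trmxCK Iu.
by rewrite /A1 !mulmxA.
Qed.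

(** The hypotheses make [r] and [s] the roots of [t^2 - (a - c) t - (k - c)]; compressing the
    quadratic equation of [A] to the blocks gives both relations for [H]. *)
Lemma model_corner r s : r + s = a%:R - c%:R -> r * s = - (k%:R - c%:R) ->
  corner_system r s L N E H.
Proof.
move=> rs1 rs2.
have [EE hE [dE IE Ed EI] dAE] := model_complement.
have Nj : c%:R *: (u^t* *m E) = j^t* *m N.
  by rewrite -[RHS]trmxCK adj_mul trmxCK model_N_ones adjZ rmorph_nat adj_mul hE.
case: modA => [[hA _] _ [dd II dI] [du Iu] Ad].
split=> //.
- by rewrite /N -[_ *m E *m E]mulmxA EE.
- split; rewrite /H; [by rewrite -[_ *m E *m E]mulmxA EE | by rewrite !mulmxA EE|].
  by rewrite !adj_mul hA hE mulmxA.
- transitivity (I^t* *m A *m E *m A *m E).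
    by rewrite /N /H !mulmxA -[_ *m E *m E]mulmxA EE.
  rewrite model_middle dAE mulmx0 subr0.
  rewrite model_sandwich IE scaler0 add0r Iu -/N -/A1 /L mulmxDl mulmxBl mul_scalar_mx.
  by rewrite addrAC -mulmxA -Nj -scalemxAr.
(* In [Z N] the first term is the all-ones contribution to [H^2], rewritten by [j^t* N = c u^t* E];
   the second removes the walks through the neighbours. *)
- exists (E *m u *m j^t* - N^t*).
  transitivity (E *m A *m E *m A *m E).
    by rewrite /H !mulmxA -[_ *m E *m E]mulmxA EE.
  rewrite model_middle dAE mulmx0 subr0 model_sandwich EE rs1 rs2 scaleNr opprK
    [(_ - N^t*) *m N]mulmxBl -[_ *m j^t* *m N]mulmxA -Nj -scalemxAr.
  have -> : N^t* = E *m A *m I by rewrite /N !adj_mul trmxCK hA hE mulmxA.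
  by rewrite -/H -/N addrA; congr (_ + _ - _); rewrite addrC.
Qed.

(** The base vertex and the off-diagonal blocks contribute no trace, so [tr A = 0] leaves
    [tr A1 + tr H = 0]. *)
Lemma model_traces : \tr E = \tr (1%:M : 'M[C]_n) - 1 - m%:R /\ \tr H = - \tr A1.
Proof.
have [EE hE [dE IE Ed EI] dAE] := model_complement.
case: modA => [[hA trA] _ [dd II dI] [du Iu] Ad]; split.
  by rewrite /E !linearB /= !(mxtrace_mulC _ (_^t*)) dd II !mxtrace1.
rewrite /H mxtrace_mulC mulmxA EE mxtrace_mulC /E !mulmxBr mulmx1 !linearB /= trA.
rewrite !mulmxA Ad ![\tr (_ *m _^t*)]mxtrace_mulC !mulmxA dI mul0mx linear0 subr0.
by rewrite sub0r.
Qed.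

Lemma model_blocks r s : r + s = a%:R - c%:R -> r * s = - (k%:R - c%:R) ->
  exists E0 N0 H0,
  [/\ corner_system r s L N0 E0 H0,
      [/\ 1%:M = d *m d^t* + I *m I^t* + E0,
          d^t* *m E0 = 0, I^t* *m E0 = 0, E0 *m d = 0 & E0 *m I = 0],
      N0 *m N0^t* = (k%:R - c%:R)%:M + (a%:R - c%:R) *: A1 + c%:R *: (j *m j^t*)
        - j *m j^t* - A1 *m A1,
      \tr E0 = \tr (1%:M : 'M[C]_n) - 1 - m%:R /\ \tr H0 = - \tr A1
    & A = (I *m j) *m d^t* + (d *m j^t* + I *m A1 + N0^t*) *m I^t* + I *m N0 + H0].
Proof.
move=> rs1 rs2; exists E, N, H.
have [EE hE [dE IE Ed EI] _] := model_complement.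
split; [exact: model_corner | split=> // | exact: model_gram | exact: model_traces |].
  by rewrite /E -[_ - _ - _]addrA -opprD [RHS]addrC subrK.
exact: model_decomposition.
Qed.

End Model.

(** * Nontrivial eigenvalues and the intertwiner of two models *)

Lemma srg_eigenvalues (C : numClosedFieldType) (k a c : nat) :
  (a < k)%N -> (c <= k)%N ->
  exists r s : C, [/\ r != s, r + s = a%:R - c%:R & r * s = - (k%:R - c%:R)].
Proof.
move=> ak ck; pose x : C := a%:R - c%:R; pose y : C := k%:R - c%:R.
(* The discriminant is a sum of nonnegative terms; its vanishing would force [a = c = k], contrary
   to [a < k]. *)
have D0 : x ^+ 2 + 4 * y != 0.
  have x2 : 0 <= x ^+ 2 by rewrite real_exprn_even_ge0 // rpredB ?realn.
  have y0 : 0 <= 4 * y by rewrite mulr_ge0 ?ler0n // subr_ge0 ler_nat.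
  rewrite paddr_eq0 // sqrf_eq0 mulf_eq0 pnatr_eq0 /=.
  rewrite !subr_eq0 !eqr_nat; apply/negP => /andP[/eqP ac /eqP kc].
  by rewrite ac kc ltnn in ak.
pose t := sqrtC (x ^+ 2 + 4 * y).
have t2 : t ^+ 2 = x ^+ 2 + 4 * y by exact: sqrtCK.
have t0 : t != 0 by rewrite sqrtC_eq0.
exists ((x + t) / 2), ((x - t) / 2); split.
- rewrite -subr_eq0 (_ : _ - _ = t) //.
  by field.
- by rewrite -/x; field.
- rewrite -/y (_ : _ * _ = (x ^+ 2 - t ^+ 2) / 4).
    by rewrite t2; field.
  by field.
Qed.

(** Used to transport the blocks of the second graph along the unitary [w], after which both graphs
    share the same [L]. *)
Lemma corner_system_unitary (C : numClosedFieldType) k n (r s : C) (L w : 'M[C]_k)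
    (N : 'M_(k, n)) (E H : 'M_n) : w \is unitarymx ->
  corner_system r s L N E H -> corner_system r s (w^t* *m L *m w) (w^t* *m N) E H.
Proof.
move=> uw [EE NE HE NH [Z HH]]; split=> //.
- by rewrite -mulmxA NE.
- by rewrite -mulmxA NH !mulmxA -[_ *m w *m _]mulmxA unitarymx_adjr // mulmx1.
- by exists (Z *m w); rewrite mulmxA -[Z *m w *m _]mulmxA unitarymx_adjr // mulmx1.
Qed.

(** [P] is the sum of [d' d^t*] at the base vertex, [I' w I^t*] on its neighbours and a corner
    intertwiner on the rest. That [w] fixes the all-ones vector matches the blocks joining the base
    vertex to its neighbours. *)
Lemma srg_model_intertwiner (k a c n m : nat) (A A' : 'M[CC]_n) (d d' : 'cV_n)
    (I I' : 'M_(n, m)) : (a < k)%N -> (c <= k)%N ->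
  srg_model k a c A d I -> srg_model k a c A' d' I' ->
  same_spectrum (I^t* *m A *m I) (I'^t* *m A' *m I') ->
  exists P Q : 'M_n, [/\ P *m Q = 1%:M, Q *m P = 1%:M, P *m A = A' *m P,
    P *m (d *m d^t*) = d' *m d'^t* *m P & P *m (I *m I^t*) = I' *m I'^t* *m P].
Proof.
move=> ak ck mA mA' sp.
have [w uw [wA wj]] := herm_cospectral_fix (model_local_herm mA) (model_local_herm mA')
  sp (rmorph_nat _ a) (model_local_regular mA) (model_local_regular mA').
have [r [s [rs rs1 rs2]]] := srg_eigenvalues CC ak ck.
have ww := unitarymx_adjl uw; have ww' := unitarymx_adjr uw.
have jw : (ones m)^t* *m w = (ones m)^t*.
  by rewrite -{1}wj adj_mul -mulmxA ww mulmx1.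
have wA' : w^t* *m (I'^t* *m A' *m I') *m w = I^t* *m A *m I.
  by rewrite -mulmxA -wA mulmxA ww mul1mx.
have wj' : w^t* *m ones m = ones m by rewrite -{1}wj mulmxA ww mul1mx.
(* [L] and the Gram matrix are polynomials in the local matrix and the all-ones matrix, both of
   which [w] matches between the two graphs. *)
have LL : w^t* *m ((a%:R - c%:R)%:M - I'^t* *m A' *m I' + ones m *m (ones m)^t*) *m w
    = (a%:R - c%:R)%:M - I^t* *m A *m I + ones m *m (ones m)^t*.
  rewrite mulmxDr mulmxBr mulmxDl mulmxBl wA' mul_mx_scalar -scalemxAl ww scalemx1.
  by rewrite mulmxA wj' -[_ *m _^t* *m w]mulmxA jw.
have hL := model_L_herm mA.
have [E [N [H [cs [sum1 dE IE Ed EI] gram [trE trH] dec]]]] := model_blocks mA rs1 rs2.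
have [E' [N' [H' [cs'' [sum1' dE' IE' Ed' EI'] gram' [trE' trH'] dec']]]] :=
  model_blocks mA' rs1 rs2.
have := corner_system_unitary uw cs''; rewrite LL => cs' {cs''}.
move: mA mA' => [[hA _] _ [dd II dI] _ _] [[hA' _] _ [dd' II' dI'] _ _].
have Id : I^t* *m d = 0 by rewrite -[LHS]trmxCK adj_mul trmxCK dI trmx0 map_mx0.
have Id' : I'^t* *m d' = 0 by rewrite -[LHS]trmxCK adj_mul trmxCK dI' trmx0 map_mx0.
have wJw : w^t* *m (ones m *m (ones m)^t*) *m w = ones m *m (ones m)^t*.
  by rewrite mulmxA wj' -mulmxA jw.
clear sp.
move: (I^t* *m A *m I) (I'^t* *m A' *m I') => A1 A1' in
  wA wA' LL hL cs cs' gram gram' trH trH' dec dec' *.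
have gg : N *m N^t* = (w^t* *m N') *m (w^t* *m N')^t*.
  rewrite adj_mul trmxCK !mulmxA -[w^t* *m N' *m _]mulmxA gram' gram.
  move: (ones m *m _) wJw => J wJw.
  rewrite !(mulmxBr, mulmxDr) !(mulmxN, mulmxBl, mulmxDl, mulNmx).
  rewrite mul_mx_scalar -!scalemxAl ww scalemx1 -!scalemxAr -!scalemxAl wA' wJw.
  by congr (_ - _); rewrite mulmxA -wA' -[RHS]mulmxA -wA [RHS]mulmxA wA'.
have trA1 : \tr A1 = \tr A1' by rewrite -wA' mxtrace_mulC mulmxA ww' mul1mx.
have trEE : \tr E = \tr E' by rewrite trE trE'.
have trHH : \tr H = \tr H' by rewrite trH trH' trA1.
have [P2 [Q2 [[PQ QP PE EP] [EQ QE] [NP PN PH]]]]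
  := corner_intertwiner rs hL cs cs' gg trEE trHH.
have Pd : P2 *m d = 0 by rewrite -PE -mulmxA Ed mulmx0.
have PI : P2 *m I = 0 by rewrite -PE -mulmxA EI mulmx0.
have dP : d'^t* *m P2 = 0 by rewrite -EP mulmxA dE' mul0mx.
have IP : I'^t* *m P2 = 0 by rewrite -EP mulmxA IE' mul0mx.
have Qd : Q2 *m d' = 0 by rewrite -QE -mulmxA Ed' mulmx0.
have QI : Q2 *m I' = 0 by rewrite -QE -mulmxA EI' mulmx0.
have dQ : d^t* *m Q2 = 0 by rewrite -EQ mulmxA dE mul0mx.
have IQ : I^t* *m Q2 = 0 by rewrite -EQ mulmxA IE mul0mx.
have NP' : N' *m P2 = w *m N by rewrite -NP !mulmxA ww' mul1mx.
have PN' : P2 *m N^t* = N'^t* *m w by rewrite PN adj_mul trmxCK.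
case: cs cs' => [[EE hE] NE [HE EH _] _ _] [_ wNE' [HE' EH' _] _ _].
have EN : E *m N^t* = N^t* by rewrite -{1}hE -adj_mul NE.
have NE' : N' *m E' = N' by rewrite -[N']mul1mx -ww' -!mulmxA [w^t* *m _]mulmxA wNE'.
have [P eP] : exists P, P = d' *m d^t* + I' *m w *m I^t* + P2 by eexists.
have [Q eQ] : exists Q, Q = d *m d'^t* + I *m w^t* *m I'^t* + Q2 by eexists.
have XPd : P *m d = d'.
  by rewrite eP !mulmxDl -!mulmxA dd Id Pd !mulmx0 mulmx1 !addr0.
have XPI : P *m I = I' *m w.
  by rewrite eP !mulmxDl -!mulmxA dI II PI !mulmx0 mulmx1 addr0 add0r.
have XPE : P *m E = P2.
  by rewrite eP !mulmxDl -!mulmxA dE IE PE !mulmx0 !add0r.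
have XdP : d'^t* *m P = d^t*.
  by rewrite eP !mulmxDr !mulmxA dd' dI' dP !mul0mx mul1mx !addr0.
have XIP : I'^t* *m P = w *m I^t*.
  by rewrite eP !mulmxDr !mulmxA Id' II' IP !mul0mx mul1mx addr0 add0r.
have XEP : E' *m P = P2.
  by rewrite eP !mulmxDr !mulmxA Ed' EI' EP !mul0mx !add0r.
have XQd : Q *m d' = d.
  by rewrite eQ !mulmxDl -!mulmxA dd' Id' Qd !mulmx0 mulmx1 !addr0.
have XQI : Q *m I' = I *m w^t*.
  by rewrite eQ !mulmxDl -!mulmxA dI' II' QI !mulmx0 mulmx1 addr0 add0r.
have XPQ2 : P *m Q2 = E' by rewrite -EQ mulmxA XPE.
have XQP2 : Q *m P2 = E.
  by rewrite eQ !mulmxDl -!mulmxA dP IP QP !mulmx0 !add0r.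
exists P, Q; split.
- rewrite sum1' {1}eQ !mulmxDr XPQ2 !mulmxA XPd XPI; congr (_ + _ + _).
  by rewrite -[_ *m w *m _]mulmxA ww' mulmx1.
- rewrite sum1 {1}eP !mulmxDr XQP2 !mulmxA XQd XQI; congr (_ + _ + _).
  by rewrite -[_ *m w^t* *m _]mulmxA ww mulmx1.
(* Each summand of the block decomposition is intertwined separately. *)
- have PNE : P *m N^t* = N'^t* *m w by rewrite -EN mulmxA XPE.
  have PHE : P *m H = P2 *m H by rewrite -{1}EH mulmxA XPE.
  have NPE : N' *m P = w *m N by rewrite -NE' -mulmxA XEP.
  have HPE : H' *m P = H' *m P2 by rewrite -{1}HE' -mulmxA XEP.
  have e1 : P *m (I *m ones m *m d^t*) = I' *m ones m *m d'^t* *m P.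
    by rewrite !mulmxA XPI -[_ *m w *m _]mulmxA wj -[RHS]mulmxA XdP.
  have e2 : P *m (d *m (ones m)^t* + I *m A1 + N^t*) =
      (d' *m (ones m)^t* + I' *m A1' + N'^t*) *m w.
    rewrite !mulmxDr !mulmxDl PNE !mulmxA XPd XPI.
    by rewrite -[_ *m w *m A1]mulmxA wA -[_ *m _^t* *m w]mulmxA jw mulmxA.
  have e3 : P *m (I *m N) = I' *m N' *m P.
    by rewrite mulmxA XPI -!mulmxA NPE.
  have e4 : P *m H = H' *m P by rewrite PHE PH HPE.
  rewrite dec dec' 3!mulmxDr e1 e3 e4 [P *m (_ *m I^t*)]mulmxA e2 -[_ *m w *m _]mulmxA.
  by rewrite -XIP [_ *m (I'^t* *m P)]mulmxA -!mulmxDl.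
- by rewrite mulmxA XPd -mulmxA XdP.
- by rewrite mulmxA XPI -[RHS]mulmxA XIP mulmxA.
Qed.

(** * Strongly regular graphs and their matrices *)

Section StronglyRegular.
Variables (T : finType) (e : rel T) (n k a c : nat).
Hypotheses (sym_e : symmetric e) (irr_e : irreflexive e)
  (conn_e : connected_graph e) (srg_e : is_srg e n k a c).

(** If [c = 0], distinct vertices with a common neighbour are adjacent; along a path from [x] every
    vertex then stays equal or adjacent to [x], so connectedness contradicts the non-adjacent
    pair. *)
Lemma srg_c_gt0 : (0 < c)%N.
Proof.
case: srg_e => [_ _ _ hc [x [y [xy exy]]]]; rewrite lt0n; apply/negP => /eqP c0.
have step u v w : (u == v) || e u v -> e v w -> (u == w) || e u w.
  move=> uv vw; apply: contraT; rewrite negb_or => /andP[uw euw].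
  have := hc _ _ uw euw; rewrite c0 => /eqP; rewrite cards_eq0 => /eqP/setP/(_ v).
  rewrite !inE (sym_e w) vw andbT; case/orP: uv => [/eqP uv|-> //].
  by rewrite uv vw in euw.
have reach p v : path e v p -> (x == v) || e x v -> (x == last v p) || e x (last v p).
  by elim: p v => [//|w p IH] v /= /andP[vw wp] xv; apply: IH => //; apply: step vw.
have /connectP[p ep Ey] := conn_e x y.
have := reach p x ep; rewrite eqxx -Ey => /(_ isT).
by rewrite (negPf xy) (negPf exy).
Qed.

Lemma srg_nonadjacent x y : x != y -> ~~ e x y -> exists2 z, e x z & e y z.
Proof.
move=> xy exy; case: srg_e => [_ _ _ hc _]; have := srg_c_gt0.
rewrite -(hc x y xy exy) card_gt0 => /set0Pn[z]; rewrite inE => /andP[xz yz].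
by exists z.
Qed.

(** Let [z] be a common neighbour of the non-adjacent [x] and [y]. Then [z] is a neighbour of [x]
    but not a common neighbour of [x] and [z], and [y] lies outside the closed neighbourhood of
    [x]. *)
Lemma srg_bounds : [/\ (a < k)%N, (c <= k)%N & (k.+1 < n)%N].
Proof.
case: (srg_e) => [hn hk ha hc [x [y [xy exy]]]].
have [z xz yz] := srg_nonadjacent xy exy.
have xz' : x != z by apply: contraTneq xz => <-; rewrite irr_e.
split.
- rewrite -(ha x z xz' xz) -(hk x); apply: proper_card; apply/properP; split.
    by apply/subsetP => w; rewrite !inE => /andP[].
  by exists z; rewrite !inE ?irr_e ?andbF.
- rewrite -(hc x y xy exy) -(hk x); apply: subset_leq_card.
  by apply/subsetP => w; rewrite !inE => /andP[].
- rewrite -(hk x) -hn; have -> : #|[set w | e x w]|.+1 = #|x |: [set w | e x w]|.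
    by rewrite cardsU1 inE irr_e.
  rewrite -cardsT; apply: proper_card; apply/properP; split; first exact: subsetT.
  by exists y; rewrite !inE // negb_or eq_sym xy.
Qed.

Lemma srg_dist x y : dist e x y = if x == y then 0%N else if e x y then 1%N else 2%N.
Proof.
have [ak _ kn] := srg_bounds; case: (srg_e) => [hn _ _ _ _].
(* [dist] tries only radii below [#|T|], so radius two is reached only with at least three
   vertices. *)
have n3 : (2 < n)%N by apply: leq_trans kn; rewrite !ltnS (leq_ltn_trans _ ak).
rewrite /dist hn; case: n n3 => [|[|[|l]]] // _.
rewrite /= !inE eq_sym; case: (eqVneq x y) => //= xy.
have in1 w : (w \in [set z | [exists y0 in [set x], e y0 z]]) = e x w.
  rewrite inE; apply/exists_inP/idP => [[v]|xw]; first by rewrite inE => /eqP->.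
  by exists x; rewrite ?inE.
have -> : [exists y0 in [set x], e y0 y] = e x y by rewrite -in1 inE.
case: (boolP (e x y)) => //= exy.
have -> // : [exists y0 in [set x] :|: [set z | [exists y0 in [set x], e y0 z]], e y0 y].
have [z xz yz] := srg_nonadjacent xy exy.
by apply/exists_inP; exists z; rewrite 1?sym_e // in_setU in1 xz orbT.
Qed.

Lemma srg_diam : diam e = 2.
Proof.
apply/eqP; rewrite eqn_leq; apply/andP; split.
  by apply/bigmax_leqP => x _; apply/bigmax_leqP => y _;
    rewrite srg_dist; case: ifP => // _; case: ifP.
case: srg_e => [_ _ _ _ [x [y [xy exy]]]].
apply: leq_trans (leq_bigmax x); apply: leq_trans (leq_bigmax y).
by rewrite srg_dist (negPf xy) (negPf exy).
Qed.

End StronglyRegular.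

(** * Matrices of a graph relative to a base vertex *)

Lemma sum_boolR (R : pzRingType) (T : finType) (P : pred T) :
  \sum_(y : T) (P y)%:R = #|[set y | P y]|%:R :> R.
Proof.
rewrite -natr_sum -sum1_card [in RHS]big_mkcond; congr _%:R.
by apply: eq_bigr => y _; rewrite inE; case: (P y).
Qed.

Lemma sum_ord_enum (R : nmodType) (T : finType) (F : T -> R) :
  \sum_(i < #|T|) F (enum_val i) = \sum_(y : T) F y.
Proof. by rewrite [RHS]big_enum_val. Qed.

Lemma sum_dirac (R : pzRingType) (T : finType) (A : {pred T}) (z : T) (F : T -> R) :
  \sum_(y in A) (y == z)%:R * F y = (z \in A)%:R * F z.
Proof.
rewrite big_mkcond (bigD1 z) //= big1 => [|y /negPf ->]; last by rewrite mul0r if_same.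
by rewrite eqxx mul1r addr0; case: ifP; rewrite ?mul1r ?mul0r.
Qed.

Section Incidence.
Variables (T : finType) (e : rel T) (x : T).

Definition vertex_vec : 'cV[CC]_#|T| := \col_i (enum_val i == x)%:R.

Definition nbhd_incl : 'M[CC]_(#|T|, #|nbhd e x|) :=
  \matrix_(i, j) (enum_val i == @enum_val T (mem (nbhd e x)) j)%:R.

Lemma sum_nbhd_incl i (F : T -> CC) :
  \sum_j nbhd_incl i j * F (@enum_val T (mem (nbhd e x)) j)
    = (e x (enum_val i))%:R * F (enum_val i).
Proof.
under eq_bigr => j _ do rewrite mxE eq_sym.
rewrite -(big_enum_val (fun z => (z == enum_val i)%:R * F z)) /=.
by rewrite (sum_dirac (mem (nbhd e x))) inE.
Qed.

Lemma sum_vertex_vec (F : T -> CC) :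
  \sum_i (vertex_vec i 0) * F (enum_val i) = F x.
Proof.
under eq_bigr => i _ do rewrite mxE.
by rewrite (sum_ord_enum (fun y => (y == x)%:R * F y)) (sum_dirac predT) mul1r.
Qed.

Lemma sum_nbhd_incl_col j (F : T -> CC) :
  \sum_i nbhd_incl i j * F (enum_val i) = F (@enum_val T (mem (nbhd e x)) j).
Proof.
under eq_bigr => i _ do rewrite mxE.
rewrite (sum_ord_enum (fun y => (y == _)%:R * F y)).
by rewrite (sum_dirac predT) mul1r.
Qed.

Lemma vertex_vec_adj i j : vertex_vec^t* i j = vertex_vec j i.
Proof. by rewrite !mxE rmorph_nat. Qed.

Lemma nbhd_incl_adj i j : nbhd_incl^t* i j = nbhd_incl j i.
Proof. by rewrite !mxE rmorph_nat. Qed.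

Lemma local_adjmxE : nbhd_incl^t* *m adjmx e *m nbhd_incl = local_adjmx e x.
Proof.
apply/matrixP=> i j; rewrite !mxE.
have rowE l : (nbhd_incl^t* *m adjmx e) i l
    = (e (@enum_val T (mem (nbhd e x)) i) (enum_val l))%:R.
  rewrite mxE; under eq_bigr => q _ do rewrite nbhd_incl_adj [adjmx e _ _]mxE.
  by rewrite (sum_nbhd_incl_col i (fun y => (e y (enum_val l))%:R)).
under eq_bigr => l _ do rewrite rowE mulrC.
by rewrite (sum_nbhd_incl_col j (fun y => (e _ y)%:R)).
Qed.

Hypotheses (sym_e : symmetric e) (irr_e : irreflexive e).

(** Entries of the squared adjacency matrix count common neighbours, so the quadratic equation is
    strong regularity in its three cases: equal, adjacent and non-adjacent vertices. *)
Lemma graph_model n k a c : is_srg e n k a c ->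
  srg_model k a c (adjmx e) vertex_vec nbhd_incl.
Proof.
case=> [hn hk ha hc _]; split; first split.
- by apply/matrixP=> i j; rewrite !mxE rmorph_nat sym_e.
- by rewrite /mxtrace big1 // => i _; rewrite mxE irr_e.
- apply/matrixP=> i j; rewrite !mxE.
  under eq_bigr => l _ do rewrite !mxE -natrM mulnb (sym_e _ (enum_val j)).
  rewrite (sum_ord_enum (fun z => (e (enum_val i) z && e (enum_val j) z)%:R)) sum_boolR.
  rewrite big_ord1 !mxE rmorph1 !mulr1 -(inj_eq enum_val_inj).
  have [<-|ij] := eqVneq; last case: (boolP (e _ _)) => eij.
  + rewrite irr_e mulr0 addr0 mulr1n subrK -(hk (enum_val i)).
    by congr (#|pred_of_set _|%:R); apply/setP => z; rewrite !inE andbb.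
  + by rewrite (ha _ _ ij eij) mulr0n add0r mulr1 subrK.
  + by rewrite (hc _ _ ij eij) mulr0n add0r mulr0 add0r.
- split; apply/matrixP=> i j; rewrite !mxE.
  + rewrite (ord1 i) (ord1 j).
    under eq_bigr => l _ do rewrite vertex_vec_adj.
    under eq_bigr => l _ do rewrite [X in _ * X]mxE.
    by rewrite (sum_vertex_vec (fun y => (y == x)%:R)) eqxx.
  + under eq_bigr => l _ do rewrite nbhd_incl_adj [X in _ * X]mxE.
    rewrite (sum_nbhd_incl_col i (fun y => (y == _)%:R)).
    by rewrite (inj_eq enum_val_inj).
  + rewrite (ord1 i); under eq_bigr => l _ do rewrite vertex_vec_adj [X in _ * X]mxE.
    rewrite (sum_vertex_vec (fun y => (y == _)%:R)).
    have := enum_valP j; rewrite inE; case: eqP => // <-; by rewrite irr_e.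
- split; apply/matrixP=> i j; rewrite !mxE.
  + rewrite (ord1 i) (ord1 j).
    under eq_bigr => l _ do rewrite vertex_vec_adj [X in _ * X]mxE.
    by rewrite (sum_vertex_vec (fun=> 1)).
  + under eq_bigr => l _ do rewrite nbhd_incl_adj [X in _ * X]mxE.
    by rewrite (sum_nbhd_incl_col i (fun=> 1)).
- apply/matrixP=> i j; rewrite !mxE.
  rewrite (ord1 j); under eq_bigr => l _ do rewrite mulrC [X in _ * X]mxE.
  rewrite (sum_vertex_vec (fun y => (e (enum_val i) y)%:R)).
  under eq_bigr => l _ do rewrite [X in _ * X]mxE.
  by rewrite (sum_nbhd_incl i (fun=> 1)) mulr1 sym_e.
Qed.

Lemma adjmx_ones n k a c : is_srg e n k a c -> adjmx e *m const_mx 1 = k%:R *: ones #|T|.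
Proof.
case=> [_ hk _ _ _]; apply/matrixP=> i j; rewrite !mxE mulr1.
under eq_bigr => l _ do rewrite !mxE mulr1.
by rewrite (sum_ord_enum (fun y => (e (enum_val i) y)%:R)) sum_boolR hk.
Qed.

(** Distances take only the values 0, 1 and 2, so the dual idempotents are the three projections of
    the model. *)
Lemma Estar_model n k a c : connected_graph e -> is_srg e n k a c ->
  [/\ Estar e x 0 = vertex_vec *m vertex_vec^t*,
      Estar e x 1 = nbhd_incl *m nbhd_incl^t*
    & Estar e x 2 = 1%:M - vertex_vec *m vertex_vec^t* - nbhd_incl *m nbhd_incl^t*].
Proof.
move=> conn_e srg_e.
have D i j : (vertex_vec *m vertex_vec^t*) i j = ((i == j) && (x == enum_val i))%:R.
  rewrite mxE big_ord1 vertex_vec_adj !mxE -natrM mulnb; congr (nat_of_bool _)%:R.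
  rewrite -(inj_eq enum_val_inj) eq_sym; case: eqP => [<-|] /=; last first.
    by rewrite andbF.
  by rewrite andbT eq_sym.
have N i j : (nbhd_incl *m nbhd_incl^t*) i j = ((i == j) && e x (enum_val i))%:R.
  rewrite mxE; under eq_bigr => l _ do rewrite nbhd_incl_adj [nbhd_incl j l]mxE.
  rewrite (sum_nbhd_incl i (fun y => (enum_val j == y)%:R)) (inj_eq enum_val_inj).
  by rewrite -natrM mulnb andbC eq_sym.
have dE := srg_dist sym_e irr_e conn_e srg_e.
have subE (X Y : 'M[CC]_#|T|) i j : (1%:M - X - Y) i j = (i == j)%:R - X i j - Y i j.
  by rewrite !mxE.
split; apply/matrixP=> i j; rewrite ?subE ?D ?N mxE dE; case: (i == j) => //=;
  rewrite ?subr0 //; case: (eqVneq x (enum_val i)) => [xi|_]; rewrite -?xi ?irr_e //;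
  by case: (e x _); rewrite ?subr0 ?subrr ?sub0r.
Qed.
End Incidence.

(** * Recovering parameters and local spectra from an intertwiner *)

Lemma spectrum_intertwined m m' (w : 'M[CC]_(m', m)) (w' : 'M[CC]_(m, m'))
    (B : 'M[CC]_m) (B' : 'M[CC]_m') :
  m = m' -> w *m w' = 1%:M -> w *m B = B' *m w -> same_spectrum B B'.
Proof.
move=> mm'; subst m' => ww' wB l; rewrite -(spectrum_similar B ww') wB.
by rewrite -mulmxA ww' mulmx1.
Qed.

(** Written with [A] and the projection [d d^t*] only, which an intertwiner respects, so that [k]
    can be compared between graphs. *)
Lemma model_degree (k a c n m : nat) (A : 'M[CC]_n) (d : 'cV_n) (I : 'M_(n, m)) :
  srg_model k a c A d I ->
  d *m d^t* *m A *m A *m (d *m d^t*) = k%:R *: (d *m d^t*).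
Proof.
move=> mA; case: (mA) => [[hA _] _ [dd II dI] [du Iu] Ad].
have ud : (ones n)^t* *m d = 1%:M by rewrite -[LHS]trmxCK adj_mul trmxCK du adj1.
have := model_sandwich mA (d^t*) d.
rewrite dd -[_ *m A *m d]mulmxA Ad [d^t* *m (I *m _)]mulmxA dI mul0mx scaler0 addr0.
rewrite du ud mulmx1 -scalerDl subrK => E.
rewrite !mulmxA -[d *m _ *m A *m A]mulmxA -[d *m _ *m (A *m A)]mulmxA.
by rewrite -[d *m _ *m d]mulmxA E -scalemxAr mulmx1 -scalemxAl.
Qed.
Lemma model_local (k a c n m : nat) (A : 'M[CC]_n) (d : 'cV_n) (I : 'M_(n, m)) :
  srg_model k a c A d I ->
  I *m I^t* *m A *m A *m (d *m d^t*) = a%:R *: (A *m (d *m d^t*)).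
Proof.
move=> mA; have Aj := model_local_regular mA; case: mA => [_ _ _ _ Ad].
rewrite !mulmxA -[_ *m A *m A *m d]mulmxA Ad.
have -> : I *m I^t* *m A *m (I *m ones m) = I *m (I^t* *m A *m I *m ones m).
  by rewrite !mulmxA.
by rewrite Aj -scalemxAr -scalemxAl.
Qed.

Section Conjugation.
Variables (k a c k' a' c' n n' m m' : nat).
Variables (A : 'M[CC]_n) (d : 'cV[CC]_n) (I : 'M[CC]_(n, m)).
Variables (A' : 'M[CC]_n') (d' : 'cV[CC]_n') (I' : 'M[CC]_(n', m')).
Variables (P : 'M[CC]_(n', n)) (Q : 'M[CC]_(n, n')).
Hypotheses (mA : srg_model k a c A d I) (mA' : srg_model k' a' c' A' d' I').
Hypotheses (PQ : P *m Q = 1%:M) (PA : P *m A = A' *m P).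
Hypotheses (Pd : P *m (d *m d^t*) = d' *m d'^t* *m P).
Hypotheses (PI : P *m (I *m I^t*) = I' *m I'^t* *m P).

(** Conjugation by [P] carries one degree relation to the other, and [d' d'^t*] is nonzero, so the
    scalars agree. *)
Lemma intertwined_degree : k = k'.
Proof.
have := model_degree mA'; have := model_degree mA.
case: mA' => [_ _ [dd _ _] _ _].
have D0 : d' *m d'^t* != 0.
  apply/eqP => D0; have := congr1 (mulmx (d'^t*)) D0.
  rewrite mulmxA dd mul1mx mulmx0 => d0; move: dd.
  by rewrite d0 mul0mx => /matrixP/(_ 0 0)/eqP; rewrite !mxE eq_sym oner_eq0.
move: (d *m d^t*) (d' *m d'^t*) Pd D0 => D D' PD D0 kD kD'.
have : P *m (D *m A *m A *m D) = D' *m A' *m A' *m D' *m P.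
  by rewrite !mulmxA PD -[D' *m P *m A]mulmxA PA !mulmxA -[_ *m P *m A]mulmxA PA !mulmxA
    -[_ *m P *m D]mulmxA PD !mulmxA.
rewrite kD kD' -scalemxAr PD -scalemxAl => /(congr1 (mulmxr Q)) /=.
rewrite -!scalemxAl -!mulmxA PQ mulmx1 => /eqP; rewrite -subr_eq0 -scalerBl scaler_eq0.
by rewrite (negPf D0) orbF subr_eq0 eqr_nat => /eqP.
Qed.

(** The scalars are now compared on [A' d' d'^t*], which is nonzero because the base vertex has a
    neighbour. *)
Lemma intertwined_local_degree : (0 < m')%N -> a = a'.
Proof.
move=> m0; have := model_local mA'; have := model_local mA.
case: mA' => [_ _ [dd II _] _ Ad].
have D0 : A' *m (d' *m d'^t*) != 0.
  apply/eqP => D0; have := congr1 (fun X => I'^t* *m X *m d') D0.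
  rewrite !mulmxA -[_ *m d'^t* *m d']mulmxA dd mulmx1 -mulmxA Ad mulmxA II mul1mx.
  rewrite mulmx0 mul0mx => /matrixP/(_ (Ordinal m0) 0)/eqP.
  by rewrite !mxE oner_eq0.
move: (d *m d^t*) (d' *m d'^t*) (I *m I^t*) (I' *m I'^t*) Pd PI D0.
move=> D D' E E' PD PE D0 aD aD'.
have : P *m (E *m A *m A *m D) = E' *m A' *m A' *m D' *m P.
  by rewrite !mulmxA PE -[E' *m P *m A]mulmxA PA !mulmxA -[_ *m P *m A]mulmxA PA !mulmxA
    -[_ *m P *m D]mulmxA PD !mulmxA.
rewrite aD aD' -scalemxAr mulmxA PA -mulmxA PD -scalemxAl mulmxA.
move=> /(congr1 (mulmxr Q)) /=.
rewrite -!scalemxAl -!mulmxA PQ mulmx1 => /eqP; rewrite -subr_eq0 -scalerBl scaler_eq0.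
by rewrite (negPf D0) orbF subr_eq0 eqr_nat => /eqP.
Qed.

(** [P] respects the projections onto the neighbours, so its compression [I'^t* P I] is invertible,
    with inverse [I^t* Q I'], and intertwines the local matrices. *)
Lemma intertwined_local_spectrum : m = m' ->
  same_spectrum (I^t* *m A *m I) (I'^t* *m A' *m I').
Proof.
case: mA mA' => [_ _ [_ II _] _ _] [_ _ [_ II' _] _ _] mm'.
have PI' : P *m I = I' *m (I'^t* *m P *m I).
  by rewrite !mulmxA -PI -mulmxA -[_ *m I^t* *m I]mulmxA II mulmx1.
have IP : I'^t* *m P *m I *m I^t* = I'^t* *m P.
  by rewrite -[_ *m I *m _]mulmxA -mulmxA PI !mulmxA II' mul1mx.
apply: (@spectrum_intertwined _ _ (I'^t* *m P *m I) (I^t* *m Q *m I')) => //.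
  by rewrite !mulmxA IP -[_ *m P *m Q]mulmxA PQ mulmx1 II'.
transitivity (I'^t* *m A' *m (P *m I)); last by rewrite {1}PI' !mulmxA.
by rewrite !mulmxA IP -[_ *m P *m A]mulmxA PA !mulmxA.
Qed.

End Conjugation.

(** The quadratic equation is applied to the all-ones vector, an eigenvector of [A] for [k]. *)
Lemma srg_count (T : finType) (e : rel T) (n k a c : nat) :
  symmetric e -> irreflexive e -> is_srg e n k a c ->
  k%:R * k%:R = k%:R - c%:R + (a%:R - c%:R) * k%:R + c%:R * n%:R :> CC.
Proof.
move=> sym_e irr_e srg_e; have Au := adjmx_ones srg_e.
case: (srg_e) => [hn _ _ _ [x _]].
have [_ AA _ _ _] := graph_model x sym_e irr_e srg_e.
have := congr1 (mulmx^~ (ones #|T|)) AA.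
rewrite /= -mulmxA Au -scalemxAr Au !mulmxDl mul_scalar_mx -!scalemxAl Au -mulmxA.
move=> /matrixP/(_ (enum_rank x) 0); rewrite !mxE !mulr1 => ->; congr (_ + _ * _).
rewrite big_ord1 !mxE mul1r; under eq_bigr => i _ do rewrite !mxE rmorph1 mulr1.
by rewrite sumr_const card_ord hn.
Qed.

(** * T-isomorphisms *)

Lemma mx_vec_inj (R : nzRingType) m n (A B : 'M[R]_(m, n)) :
  (forall v : 'cV_n, A *m v = B *m v) -> A = B.
Proof.
by move=> AB; apply/matrixP=> i j; have /matrixP/(_ i 0) := AB (delta_mx j 0);
  rewrite -!colE !mxE.
Qed.

Lemma linear_fun_mx (R : comNzRingType) m n (f : 'cV[R]_n -> 'cV[R]_m) :
  (forall a u v, f (a *: u + v) = a *: f u + f v) ->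
  exists P : 'M[R]_(m, n), forall v, f v = P *m v.
Proof.
move=> lin_f; exists (\matrix_(i, j) f (delta_mx j 0) i 0) => v.
have f0 : f 0 = 0.
  have := lin_f 1 0 0; rewrite !scale1r addr0 => /eqP.
  by rewrite -subr_eq subrr eq_sym => /eqP.
have fD u w : f (u + w) = f u + f w by have := lin_f 1 u w; rewrite !scale1r.
have fZ b u : f (b *: u) = b *: f u by have := lin_f b u 0; rewrite !addr0 f0 addr0.
have Ev : v = \sum_j v j 0 *: delta_mx j 0.
  by rewrite {1}[v]matrix_sum_delta; apply: eq_bigr => j _; rewrite big_ord1.
rewrite {1}Ev (big_morph f fD f0); apply/matrixP=> i j; rewrite (ord1 j) summxE !mxE.
by apply: eq_bigr => l _; rewrite fZ !mxE mulrC.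
Qed.

Lemma linear_bijection_mx (R : comNzRingType) m n (f : 'cV[R]_n -> 'cV[R]_m) :
  (forall a u v, f (a *: u + v) = a *: f u + f v) -> bijective f ->
  exists P Q, [/\ P *m Q = 1%:M, Q *m P = 1%:M & forall v, f v = P *m v].
Proof.
move=> lin_f [g fK gK]; have [P fP] := linear_fun_mx lin_f.
have [Q gQ] : exists Q, forall v, g v = Q *m v.
  apply: linear_fun_mx => b u v; apply: (can_inj fK).
  by rewrite lin_f !gK.
exists P, Q; split=> //; apply: mx_vec_inj => v; rewrite -mulmxA mul1mx.
  by rewrite -gQ -fP gK.
by rewrite -fP -gQ fK.
Qed.

(** The matrices whose conjugate lies in the target algebra are closed under the algebra operations,
    so they may serve as the test predicate of [alg_gen]. *)
Lemma alg_gen_conj n n' (G : 'M[CC]_n -> Prop) (G' : 'M[CC]_n' -> Prop)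
    (P : 'M[CC]_(n', n)) (Q : 'M[CC]_(n, n')) :
  P *m Q = 1%:M -> Q *m P = 1%:M -> (forall g, G g -> G' (P *m g *m Q)) ->
  forall B, alg_gen G B -> alg_gen G' (P *m B *m Q).
Proof.
move=> PQ QP GG B GB; apply: (GB (fun B => alg_gen G' (P *m B *m Q))).
- by move=> S S1 _ _ _; rewrite mulmx1 PQ.
- move=> b u v Su Sv S S1 Sl Sm Sg.
  by rewrite mulmxDr mulmxDl -scalemxAr -scalemxAl; apply: (Sl); [apply: Su | apply: Sv].
- move=> u v Su Sv S S1 Sl Sm Sg.
  have -> : P *m (u *m v) *m Q = P *m u *m Q *m (P *m v *m Q).
    by rewrite !mulmxA -[_ *m Q *m P]mulmxA QP mulmx1.
  by apply: (Sm); [apply: Su | apply: Sv].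
- by move=> g /GG Gg S _ _ _; apply.
Qed.

Section Intertwiner.
Variables (T T' : finType) (e : rel T) (e' : rel T') (x : T) (x' : T').

Definition T_intertwiner (P : 'M[CC]_(#|T'|, #|T|)) : Prop :=
  P *m adjmx e = adjmx e' *m P /\
  forall m, (m <= diam e)%N -> P *m Estar e x m = Estar e' x' m *m P.

Lemma T_intertwiner_iso (P : 'M[CC]_(#|T'|, #|T|)) (Q : 'M[CC]_(#|T|, #|T'|)) :
  diam e = diam e' -> P *m Q = 1%:M -> Q *m P = 1%:M -> T_intertwiner P ->
  exists f : 'M[CC]_#|T| -> 'M[CC]_#|T'|,
      [/\ alg_iso (Talg e x) (Talg e' x') f,
          f (adjmx e) = adjmx e',
          (forall m, (m <= diam e)%N -> f (Estar e x m) = Estar e' x' m)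
        & exists rho : 'cV[CC]_#|T| -> 'cV[CC]_#|T'|,
            [/\ (forall a u v, rho (a *: u + v) = a *: rho u + rho v),
                bijective rho
              & (forall B, Talg e x B -> forall v, rho (B *m v) = f B *m rho v)]].
Proof.
move=> de PQ QP [PA PE]; exists (fun B => P *m B *m Q).
have fA : P *m adjmx e *m Q = adjmx e' by rewrite PA -mulmxA PQ mulmx1.
have fE m : (m <= diam e)%N -> P *m Estar e x m *m Q = Estar e' x' m.
  by move=> /PE ->; rewrite -mulmxA PQ mulmx1.
have QPK n (B : 'M_(_, n)) : Q *m (P *m B) = B by rewrite mulmxA QP mul1mx.
have PQK n (B : 'M_(_, n)) : P *m (Q *m B) = B by rewrite mulmxA PQ mul1mx.
split=> //.
- split.
  + apply: alg_gen_conj => // g [->|[m dm ->]]; first by left.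
    by right; exists m; rewrite -?de ?fE.
  + move=> B' TB'; exists (Q *m B' *m P); last by rewrite -!mulmxA PQ mulmx1 PQK.
    move: B' TB'; apply: alg_gen_conj => // g [->|[m dm ->]]; [left | right].
      by rewrite -fA -!mulmxA QP mulmx1 QPK.
    by exists m; rewrite ?de // -fE ?de // -!mulmxA QP mulmx1 QPK.
  + move=> B1 B2 _ _ /(congr1 (fun X => Q *m X *m P)).
    by rewrite -!mulmxA QP !mulmx1 !QPK.
  + split=> [|b B1 B2 _ _]; first by rewrite mulmx1 PQ.
    by rewrite mulmxDr mulmxDl -scalemxAr -scalemxAl.
  + by move=> B1 B2 _ _; rewrite -!mulmxA QPK.
- exists (mulmx P); split=> [b u v||B _ v].
  + by rewrite mulmxDr -scalemxAr.
  + by exists (mulmx Q) => v; rewrite ?QPK ?PQK.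
  + by rewrite -!mulmxA QPK.
Qed.

Lemma T_isomorphic_intertwiner : T_isomorphic e e' ->
  exists P Q, [/\ P *m Q = 1%:M, Q *m P = 1%:M & T_intertwiner P].
Proof.
move=> [_ /(_ x x')[_ [f [_ fA fE [rho [lin_rho bij_rho rhoB]]]]]].
have [P [Q [PQ QP rhoP]]] := linear_bijection_mx lin_rho bij_rho.
exists P, Q; split=> //; split=> [|m dm]; apply: mx_vec_inj => v.
  rewrite -!mulmxA -!rhoP -fA rhoB // => S _ _ _; apply; by left.
by rewrite -!mulmxA -!rhoP -fE // rhoB // => S _ _ _; apply; right; exists m.
Qed.

End Intertwiner.

(** Cardinals of different vertex sets are only provably equal, so the dimensions are variables
    here, to be substituted. *)
Lemma srg_model_intertwiner_cast (k a c n n' m m' : nat) (A : 'M[CC]_n) (d : 'cV_n)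
    (I : 'M_(n, m)) (A' : 'M[CC]_n') (d' : 'cV_n') (I' : 'M_(n', m')) :
  n = n' -> m = m' -> (a < k)%N -> (c <= k)%N ->
  srg_model k a c A d I -> srg_model k a c A' d' I' ->
  same_spectrum (I^t* *m A *m I) (I'^t* *m A' *m I') ->
  exists P Q, [/\ P *m Q = 1%:M, Q *m P = 1%:M, P *m A = A' *m P,
    P *m (d *m d^t*) = d' *m d'^t* *m P & P *m (I *m I^t*) = I' *m I'^t* *m P].
Proof. by move=> nn mm; subst n' m'; apply: srg_model_intertwiner. Qed.

Theorem theorem5p12 (T T' : finType) (e : rel T) (e' : rel T')
    (n k a c n' k' a' c' : nat) :
  symmetric e -> irreflexive e -> symmetric e' -> irreflexive e' ->
  connected_graph e -> connected_graph e' ->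
  is_srg e n k a c -> is_srg e' n' k' a' c' ->
  (T_isomorphic e e' <->
     ((n, k, a, c) = (n', k', a', c') /\
      forall (x : T) (x' : T'), same_spectrum (local_adjmx e x) (local_adjmx e' x'))).
Proof.
move=> sym_e irr_e sym_e' irr_e' conn_e conn_e' srg_e srg_e'.
have diam_e := srg_diam sym_e irr_e conn_e srg_e.
have diam_e' := srg_diam sym_e' irr_e' conn_e' srg_e'.
have model x := graph_model x sym_e irr_e srg_e.
have model' x' := graph_model x' sym_e' irr_e' srg_e'.
have star x := Estar_model x sym_e irr_e conn_e srg_e.
have star' x' := Estar_model x' sym_e' irr_e' conn_e' srg_e'.
have deg x : #|nbhd e x| = k by case: srg_e => [_ ->].
have deg' x' : #|nbhd e' x'| = k' by case: srg_e' => [_ ->].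
have T_eq : n = n' -> #|T| = #|T'|.
  by case: (srg_e) (srg_e') => [-> _ _ _ _] [-> _ _ _ _].
have [ak ck kn] := srg_bounds sym_e irr_e conn_e srg_e.
split=> [iso | [[? ? ? ?] spec]]; last first.
- subst n' k' a' c'.
  split=> [|x x']; first by rewrite diam_e diam_e'.
  split; first exact: T_eq.
  have [||P [Q [PQ QP PA Pd PI]]] :=
    srg_model_intertwiner_cast (T_eq erefl) _ ak ck (model x) (model' x').
  + by rewrite deg deg'.
  + by rewrite !local_adjmxE.
  apply: T_intertwiner_iso PQ QP _; first by rewrite diam_e diam_e'.
  (* The third dual idempotent is the identity minus the other two, so intertwining those
     suffices. *)
  split=> // m; rewrite diam_e; have [s0 s1 s2] := star x; have [s0' s1' s2'] := star' x'.
  case: m => [|[|[|//]]] _; rewrite ?s0 ?s1 ?s2 ?s0' ?s1' ?s2' //.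
  by rewrite !mulmxBr !mulmxBl mulmx1 mul1mx Pd PI.
have intertwined x x' : exists P Q, [/\ P *m Q = 1%:M, Q *m P = 1%:M,
    P *m adjmx e = adjmx e' *m P,
    P *m (vertex_vec x *m (vertex_vec x)^t*)
      = vertex_vec x' *m (vertex_vec x')^t* *m P &
    P *m (nbhd_incl e x *m (nbhd_incl e x)^t*)
      = nbhd_incl e' x' *m (nbhd_incl e' x')^t* *m P].
  have [P [Q [PQ QP [PA PE]]]] := T_isomorphic_intertwiner x x' iso.
  have [s0 s1 _] := star x; have [s0' s1' _] := star' x'.
  by exists P, Q; split=> //; rewrite -?s0 -?s1 -?s0' -?s1' PE ?diam_e.
(* A T-isomorphism speaks only about given base vertices; the non-adjacent pairs supply them. *)
have [_ _ _ _ [x _]] := srg_e; have [_ _ _ _ [x' _]] := srg_e'.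
have kk' : k = k'.
  have [P [Q [PQ QP PA Pd PI]]] := intertwined x x'.
  exact: intertwined_degree (model x) (model' x') PQ PA Pd.
have aa' : a = a'.
  have [P [Q [PQ QP PA Pd PI]]] := intertwined x x'.
  apply: intertwined_local_degree (model x) (model' x') PQ PA Pd PI _.
  by rewrite deg' -kk' (leq_ltn_trans _ ak).
have nn' : n = n'.
  by case: (srg_e) (srg_e') iso => [<- _ _ _ _] [<- _ _ _ _] [_ /(_ x x')[]].
(* Equating the two counts leaves [(n - k - 1) (c - c') = 0], where [n > k + 1]. *)
have cc' : c = c'.
  have := srg_count sym_e' irr_e' srg_e'; rewrite -kk' -aa' -nn'.
  rewrite (srg_count sym_e irr_e srg_e) => count.
  have : (n%:R - k.+1%:R) * (c%:R - c'%:R) = 0 :> CC.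
    rewrite -[LHS]subr0 -[X in _ - X](subrr (k%:R - c%:R + (a%:R - c%:R) * k%:R + c%:R * n%:R)).
    rewrite {2}count -natr1; ring.
  move=> /eqP; rewrite mulf_eq0 !subr_eq0 !eqr_nat => /orP[/eqP nk|/eqP //].
  by rewrite nk ltnn in kn.
split=> [|y y']; first by rewrite nn' kk' aa' cc'.
have [P [Q [PQ QP PA Pd PI]]] := intertwined y y'.
rewrite -!local_adjmxE.
apply: intertwined_local_spectrum (model y) (model' y') PQ PA PI _.
by rewrite deg deg'.
Qed.
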